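(* Let $(\Omega,\mu)$ be a measure space and let $p\in[2,\infty)$. Let $(u_k)$ be a sequence in $L^p(\Omega,\mu)$ and let $u\in L^p(\Omega,\mu)$. Define $\Psi:\mathbb{R}\times\mathbb{R}\to\mathbb{R}$ by $$\Psi(s,t)=\begin{cases}|s|^{p-1}t, & |t|\le |s|,\\ |s|\,|t|^{p-2}t, & |t|\ge |s|.\end{cases}$$ Assume that $\Psi(u,u_k-u)\rightharpoonup 0$ in $L^1(\Omega,\mu)$. Then, as $k\to\infty$, $$\int_\Omega |u_k|^p\,d\mu\ \ge\ \int_\Omega |u|^p\,d\mu+\int_\Omega |u_k-u|^p\,d\mu+o(1).$$
   Context: Functions are real-valued; $\rightharpoonup$ denotes weak convergence as $k\to\infty$; $\Psi(u,u_k-u)$ denotes the function $x\mapsto\Psi(u(x),u_k(x)-u(x))$. The conclusion ''$a_k\ge b_k+o(1)$'' means that there is a real sequence $\varepsilon_k\to 0$ with $a_k\ge b_k+\varepsilon_k$ for all $k$. *)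

(* Defs.v *)
From HB Require Import structures.
From mathcomp Require Import all_boot all_order all_algebra.
From mathcomp Require Import all_classical all_reals all_analysis.
From mathcomp Require Import measurable_realfun.

Set Implicit Arguments.
Unset Strict Implicit.
Unset Printing Implicit Defensive.
Import Order.TTheory GRing.Theory Num.Theory.
Import numFieldNormedType.Exports.
Local Open Scope classical_set_scope.
Local Open Scope ring_scope.

(* The two formulas agree when |t| = |s|, so testing |t| <= |s| first is
   harmless; for p = 2 the convention 0 `^ 0 = 1 never matters, since the second
   formula is only reached with t != 0. *)
Definition Psi (R : realType) (p s t : R) : R :=
  if `|t| <= `|s| then `|s| `^ (p - 1) * t else `|s| * `|t| `^ (p - 2) * t.

(* [LfunType mu p1] is the vector space of functions underlying L^p, before the
   quotient by a.e. equality. A linear functional on it that is bounded for the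
   L^p seminorm is constant on a.e.-classes, so these functionals are exactly
   the elements of the dual of L^p, and the notion below is weak convergence in
   L^p for an arbitrary measure (no representation of the dual is used). *)
Definition Lp_bounded d (T : measurableType d) (R : realType)
    (mu : {measure set T -> \bar R}) (p : \bar R) (p1 : (1 <= p)%E)
    (phi : LfunType mu p1 -> R) : Prop :=
  exists C : R, forall f : LfunType mu p1,
    (`|phi f|%:E <= C%:E * 'N[mu]_p[EFin \o f])%E.

Definition Lp_weak_cvg d (T : measurableType d) (R : realType)
    (mu : {measure set T -> \bar R}) (p : \bar R) (p1 : (1 <= p)%E)
    (f_ : nat -> LfunType mu p1) (f : LfunType mu p1) : Prop :=
  forall phi : {scalar LfunType mu p1}, Lp_bounded phi ->
    phi (f_ k) @[k --> \oo] --> phi f.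

Lemma Psi_bound (R : realType) (p s t : R) : 2 <= p ->
  `|Psi p s t| <= `|s| `^ p + `|t| `^ p.
Proof.
move=> p2; have p10 : 0 < p - 1 by rewrite subr_gt0 (lt_le_trans _ p2)// ltr1n.
have powS (x : R) : `|x| `^ (p - 1) * `|x| = `|x| `^ p.
  by rewrite mulrC mulr_powRB1// (lt_le_trans _ p2).
rewrite /Psi; case: (leP `|t| `|s|) => st.
  rewrite normrM (ger0_norm (powR_ge0 _ _)).
  rewrite (@le_trans _ _ (`|s| `^ p))// ?lerDl ?powR_ge0//.
  by rewrite -[leRHS]powS ler_wpM2l// powR_ge0.
rewrite !normrM normr_id (ger0_norm (powR_ge0 _ _)).
rewrite (@le_trans _ _ (`|t| `^ p))// ?lerDr ?powR_ge0//.
have t0 : `|t| != 0 by rewrite gt_eqF// (le_lt_trans _ st).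
have -> : `|t| `^ p = `|t| * `|t| `^ (p - 2) * `|t|.
  rewrite -powS; congr (_ * _).
  have -> : p - 1 = 1 + (p - 2).
    by rewrite addrCA; congr (_ + _); rewrite -[2]/(1 + 1 : R) opprD addrA subrr sub0r.
  by rewrite (@powRD _ _ 1) ?t0 ?implybT// powRr1.
by rewrite !ler_wpM2r ?powR_ge0// ltW.
Qed.

Lemma Psi_Lfun1 d (T : measurableType d) (R : realType)
    (mu : {measure set T -> \bar R}) (p : R) (p2 : 2 <= p) (u v : T -> R)
    (uLp : u \in Lfun mu p%:E) (vLp : v \in Lfun mu p%:E) :
  (fun x => Psi p (u x) (v x - u x)) \in Lfun mu 1.
Proof.
have p1 : 1 <= p by rewrite (le_trans _ p2)// ler1n.
have p1E : (1 <= p%:E)%E by rewrite lee_fin.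
have wLp : (fun x => v x - u x) \in Lfun mu p%:E.
  exact: LfunP (Lfun_Sub p1E vLp - Lfun_Sub p1E uLp).
suff PsiL1 w : w \in Lfun mu p%:E -> (fun x => Psi p (u x) (w x)) \in Lfun mu 1.
  exact: PsiL1 wLp.
move=> {}wLp.
have mfu : measurable_fun setT u by case/andP: (uLp) => + _; rewrite inE.
have mw : measurable_fun setT w by case/andP: (wLp) => + _; rewrite inE.
have iu := Lfun_integrable p1 uLp.
have iw := Lfun_integrable p1 wLp.
have mnu : measurable_fun setT (fun x => `|u x|) by apply: measurableT_comp.
have mnw : measurable_fun setT (fun x => `|w x|) by apply: measurableT_comp.
apply/Lfun1_integrable.
apply: (le_integrable _ _ _ (integrableD _ iu iw)) => //.
  apply/measurable_EFinP; rewrite /Psi; apply: measurable_fun_ifT.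
  - exact: measurable_fun_ler.
  - apply: measurable_funM => //.
    exact: (measurableT_comp (measurable_powR _)).
  - apply: measurable_funM => //; apply: measurable_funM => //.
    exact: (measurableT_comp (measurable_powR _)).
move=> x _ /=; rewrite lee_fin.
by rewrite (le_trans (Psi_bound _ _ p2))// ler_norm.
Qed.

(* Main.v *)
Require Import Defs.
From HB Require Import structures.
From mathcomp Require Import all_boot all_order all_algebra.
From mathcomp Require Import all_classical all_reals all_analysis.
From mathcomp Require Import measurable_realfun ring lra.

Set Implicit Arguments.
Unset Strict Implicit.
Unset Printing Implicit Defensive.
Import Order.TTheory GRing.Theory Num.Theory.
Import numFieldNormedType.Exports.
Local Open Scope classical_set_scope.
Local Open Scope ring_scope.

(** The theorem is the integrated form of the pointwise inequality
      |s + t|^p >= |s|^p + |t|^p + p sgn(s) Psi(s, t)      (p >= 2)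
    at s = u(x), t = u_k(x) - u(x) (lemma [normrD_powR_ge]). The last term is a
    fixed bounded function, p sgn(u), times the weakly null sequence
    Psi(u, u_k - u); since integration against a bounded measurable function is
    a continuous functional on L^1, its integral tends to 0
    (lemma [Lp_weak_cvg1_integral]), and this integral is the o(1).

    By homogeneity, and by the symmetry exchanging s and t, the pointwise
    inequality reduces to (1 + x)^p >= 1 + p x + |x|^p for |x| <= 1. No calculus
    is needed for it: Bernoulli's inequality with exponent p - 1 >= 1 gives
      (1 + x)^p >= (1 + x) (1 + (p - 1) x) = 1 + p x + (p - 1) x^2,
    and (p - 1) x^2 >= x^2 >= |x|^p. *)

(** Bernoulli's inequality for real exponents: it is Young's inequality
    y * 1 <= y^r / r + 1 / r' with the conjugate exponent r' of r. *)
Lemma powR_bernoulli (R : realType) (r y : R) : 1 <= r -> 0 <= y ->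
  1 + r * (y - 1) <= y `^ r.
Proof.
rewrite le_eqVlt => /predU1P[<- y0|r1 y0]; first by rewrite powRr1//; lra.
have r0 : 0 < r by lra.
have conj : r^-1 + (r / (r - 1))^-1 = 1 by field; apply/andP; split; lra.
have r'0 : 0 < r / (r - 1) by rewrite divr_gt0//; lra.
have := conjugate_powR y0 ler01 r0 r'0 conj.
have -> : (r / (r - 1))^-1 = 1 - r^-1 by lra.
rewrite powR1 mulr1 -(ler_pM2l r0) mulrDr mulrCA mulfV ?gt_eqF// mulr1 mul1r.
by rewrite mulrBr mulfV ?gt_eqF// => ?; lra.
Qed.

Lemma powR1D_ge (R : realType) (p x : R) : 2 <= p -> `|x| <= 1 ->
  1 + p * x + `|x| `^ p <= (1 + x) `^ p.
Proof.
move=> p2 x1; have /andP[x1l x1r] : - 1 <= x <= 1 by rewrite -ler_norml.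
have xp : `|x| `^ p <= x ^+ 2.
  (* x = 0 is apart: [ger_powR] compares powers of a positive base only. *)
  have [->|x0] := eqVneq x 0.
    by rewrite normr0 powR0 ?expr0n// gt_eqF//; lra.
  rewrite -normr_id -real_normK ?num_real// -powR_mulrn// normr_id.
  by rewrite ger_powR// normr_gt0 x0.
rewrite -[leRHS]mulr_powRB1; [|lra..].
apply: (@le_trans _ _ ((1 + x) * (1 + (p - 1) * (1 + x - 1)))); last first.
  by rewrite ler_wpM2l//; [|apply: powR_bernoulli]; lra.
have := mulr_ge0 (_ : 0 <= p - 2) (sqr_ge0 x).
by rewrite !expr2 in xp *; lra.
Qed.

(** The homogeneous form of [powR1D_ge], with x = t / s. *)
Lemma normrD_powR_ge_tangent (R : realType) (p s t : R) : 2 <= p ->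
  `|t| <= `|s| ->
  `|s| `^ p + `|t| `^ p + p * (`|s| `^ (p - 2) * s * t) <= `|s + t| `^ p.
Proof.
move=> p2 ts; have [s0|s0] := eqVneq s 0.
  move: ts; rewrite s0 normr0 normr_le0 => /eqP ->.
  by rewrite !mulr0 !addr0 normr0 powR0 ?addr0// gt_eqF//; lra.
have sN0 : 0 < `|s| by rewrite normr_gt0.
pose x := t / s; have tE : t = s * x by rewrite /x mulrCA mulfV// mulr1.
have x1 : `|x| <= 1 by rewrite normrM normfV ler_pdivrMr// mul1r.
clearbody x.
(* As |x| <= 1, the factor 1 + x of s + t = s (1 + x) is its own modulus. *)
have x1D : 0 <= 1 + x by move: x1; rewrite ler_norml => /andP[]; lra.
have -> : `|s| `^ (p - 2) * s * t = `|s| `^ p * x.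
  rewrite tE mulrA -(mulrA _ s s) -expr2 -(@real_normK _ s) ?num_real//.
  by rewrite -powR_mulrn// -powRD ?subrK// (gt_eqF sN0) implybT.
have -> : s + t = s * (1 + x) by rewrite mulrDr mulr1 -tE.
rewrite tE !normrM (ger0_norm x1D) !powRM//.
have -> : `|s| `^ p + `|s| `^ p * `|x| `^ p + p * (`|s| `^ p * x) =
          `|s| `^ p * (1 + p * x + `|x| `^ p) by ring.
by rewrite ler_wpM2l ?powR_ge0// powR1D_ge.
Qed.

(** The sign of s is needed because [Psi] sees s only through |s|, whereas the
    cross term of |s + t|^p has the sign of s * t. *)
Lemma normrD_powR_ge (R : realType) (p s t : R) : 2 <= p ->
  `|s| `^ p + `|t| `^ p + p * Num.sg s * Psi p s t <= `|s + t| `^ p.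
Proof.
move=> p2; rewrite /Psi; case: ifPn => [ts|].
  suff -> : p * Num.sg s * (`|s| `^ (p - 1) * t) =
            p * (`|s| `^ (p - 2) * s * t) by exact: normrD_powR_ge_tangent.
  have [->|s0] := eqVneq s 0; first by rewrite sgr0 !(mulr0, mul0r).
  have -> : p - 1 = p - 2 + 1 by ring.
  rewrite powRD ?normr_eq0 ?s0 ?implybT// powRr1//.
  by rewrite [X in _ = _ * (_ * X * _)](numEsg s); ring.
rewrite -ltNge => /ltW st.
have -> : p * Num.sg s * (`|s| * `|t| `^ (p - 2) * t) =
          p * (`|t| `^ (p - 2) * t * s).
  by rewrite [X in _ = _ * (_ * X)](numEsg s); ring.
rewrite (addrC (`|s| `^ p)) (addrC s).
exact: normrD_powR_ge_tangent.
Qed.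

Lemma measurable_sgr (R : realType) : measurable_fun [set: R] (@Num.sg R).
Proof.
apply: nondecreasing_measurable => // x y xy.
have [x0|x0|x0] := ltgtP x 0.
- by rewrite (ltr0_sg x0); case: sgrP => _; lra.
- by rewrite !gtr0_sg// (lt_le_trans x0).
- by rewrite x0 sgr0 sgr_ge0 -x0.
Qed.

Lemma integrable_bounded_Lfun1 d (T : measurableType d) (R : realType)
    (mu : {measure set T -> \bar R}) (g : T -> R) (C : R) (h : T -> R) :
  measurable_fun setT g -> (forall x, `|g x| <= C) -> h \in Lfun mu 1 ->
  mu.-integrable setT (EFin \o (fun x => g x * h x)).
Proof.
move=> mg gC /Lfun1_integrable hi.
apply: (@integrableMr _ _ _ _ _ _ g (EFin \o h)) => //.
exists C; split; first exact: num_real.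
by move=> y Cy x _ /=; exact: le_trans (gC x) (ltW Cy).
Qed.

(** Bounded measurable functions are test functions for weak convergence in
    L^1, whatever the measure: only the easy half of the duality between L^1
    and L^oo is involved. *)
Lemma Lp_weak_cvg1_integral d (T : measurableType d) (R : realType)
    (mu : {measure set T -> \bar R}) (p1 : (1 <= 1 :> \bar R)%E)
    (g : T -> R) (C : R) (f_ : nat -> LfunType mu p1) (f : LfunType mu p1) :
  measurable_fun setT g -> (forall x, `|g x| <= C) -> Lp_weak_cvg f_ f ->
  (\int[mu]_x (g x * f_ k x))%R @[k --> \oo] --> (\int[mu]_x (g x * f x))%R.
Proof.
move=> mg gC f_f.
have gM_integrable (h : LfunType mu p1) :
    mu.-integrable setT (EFin \o (fun x => g x * h x)).
  exact: integrable_bounded_Lfun1 mg gC (LfunP h).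
pose phi (h : LfunType mu p1) : R := (\int[mu]_x (g x * h x))%R.
have phi_linear : scalar phi.
  move=> a h1 h2; rewrite /phi /= -RintegralZl// -RintegralD//.
  - by apply: eq_Rintegral => x _; rewrite mulrDr [g x * (_ *: _)]mulrCA.
  - have -> : EFin \o (fun x => a * (g x * h1 x)) =
              EFin \o (fun x => g x * (a *: h1) x).
      by apply/funext => x /=; congr EFin; rewrite mulrCA.
    exact: gM_integrable.
pose Phi : {scalar LfunType mu p1} :=
  HB.pack phi (GRing.isLinear.Build _ _ _ _ phi phi_linear).
apply: (f_f Phi); exists C => h; rewrite Lnorm1 /= /phi.
have hi : mu.-integrable setT (EFin \o h) by apply/Lfun1_integrable/LfunP.
rewrite EFin_normr_Rintegral// -integralZl//; last exact: (integrable_abse hi).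
apply: le_trans (le_abse_integral _ measurableT _) _.
  by case/integrableP: (gM_integrable h).
apply: ge0_le_integral => //.
- by apply: measurableT_comp => //; case/integrableP: (gM_integrable h).
- exact: measurable_funeM (measurable_int mu (integrable_abse hi)).
- by move=> x _ /=; rewrite lee_fin normrM ler_wpM2r.
Qed.

Unset Implicit Arguments.

Theorem theorem4p1 (d : measure_display) (T : measurableType d) (R : realType)
    (mu : {measure set T -> \bar R}) (p : R) (p2 : 2 <= p)
    (u_ : nat -> T -> R) (u : T -> R)
    (u_Lp : forall k, u_ k \in Lfun mu p%:E) (uLp : u \in Lfun mu p%:E)
    (Psi_weak0 : Lp_weak_cvg
       (fun k => Lfun_Sub (lexx 1%E) (Psi_Lfun1 p2 uLp (u_Lp k))) 0) :
  exists2 eps : nat -> R, eps k @[k --> \oo] --> 0 &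
    forall k,
      (\int[mu]_x (`|u_ k x| `^ p)%:E >=
       \int[mu]_x (`|u x| `^ p)%:E + \int[mu]_x (`|u_ k x - u x| `^ p)%:E
       + (eps k)%:E)%E.
Proof.
have p1 : 1 <= p by lra.
pose g x := p * Num.sg (u x).
have mu_ : measurable_fun setT u by case/andP: (uLp) => + _; rewrite inE.
have mg : measurable_fun setT g.
  apply: measurable_funM => //.
  exact: (measurableT_comp (@measurable_sgr R)).
have gp x : `|g x| <= p.
  rewrite normrM normr_sg ger0_norm; last lra.
  by case: (u x != 0); rewrite ?mulr1 ?mulr0//; lra.
(* The o(1): the pairing of the weakly null sequence with p sgn(u). *)
exists (fun k => \int[mu]_x (g x * Psi p (u x) (u_ k x - u x)))%R.
  have := Lp_weak_cvg1_integral mg gp Psi_weak0.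
  rewrite (_ : (\int[mu]_x _)%R = 0)//.
  rewrite -[RHS](mul0r (fine (mu setT))) -(Rintegral_cst mu measurableT).
  by apply: eq_Rintegral => x _; exact: mulr0.
move=> k.
have iu := Lfun_integrable p1 uLp.
have iuk := Lfun_integrable p1 (u_Lp k).
have iv : mu.-integrable setT (fun x => (`|u_ k x - u x| `^ p)%:E).
  apply: (Lfun_integrable p1).
  have p1E : (1 <= p%:E)%E by rewrite lee_fin.
  exact: LfunP (Lfun_Sub p1E (u_Lp k) - Lfun_Sub p1E uLp).
have ig : mu.-integrable setT
    (EFin \o (fun x => g x * Psi p (u x) (u_ k x - u x))).
  exact: integrable_bounded_Lfun1 mg gp (Psi_Lfun1 p2 uLp (u_Lp k)).
rewrite /Rintegral fineK; last exact: integrable_fin_num.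
rewrite -!integralD//; last exact: integrableD.
apply: le_integral => //; first by apply: integrableD => //; exact: integrableD.
move=> x _; rewrite lee_fin.
have := normrD_powR_ge (u x) (u_ k x - u x) p2.
by rewrite (addrC (u x) (_ - _)) subrK.
Qed.
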